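(* Let $G$ be the cubic graph of order $52$ constructed as follows from three disjoint copies $F_1,F_2,F_3$ of the $17$-vertex $5$-pole $F$ (defined in the context). Write $R_i=\{r^1_i,r^2_i\}$, $B_i=\{b^1_i,b^2_i\}$ and $e_i$ for the red dangling edges, the blue dangling edges and the green dangling edge of $F_i$. For each $i\in\{1,2,3\}$ (indices modulo $3$), the edges $B_i$ of $F_i$ are joined to the edges $R_{i+1}$ of $F_{i+1}$, with $b^1_i$ joined to $r^2_{i+1}$ and $b^2_i$ joined to $r^1_{i+1}$; and the three edges $e_1,e_2,e_3$ meet at one additional central vertex $v$. Then $G$ does not admit a Petersen coloring.
   Context: $P$ denotes the Petersen graph. For a vertex $u$ of a graph (or multipole) $G$, $\partial_G(u)$ is the set of edges (including dangling edges) incident to $u$. A Petersen coloring of a cubic graph $G$ is a map $\varphi:E(G)\to E(P)$ that maps any two adjacent edges of $G$ to two adjacent (distinct, sharing a vertex) edges of $P$; equivalently, for every vertex $v$ of $G$ there is a vertex $w$ of $P$ with $\varphi(\partial_G(v))=\partial_P(w)$. A multipole is a graph-like structure with vertices and edges in which some ends of edges may be free, i.e. not incident to a vertex; an edge with exactly one free end and one end incident to a vertex is a dangling edge, and a multipole with exactly $k$ free ends is a $k$-pole. It is cubic if each vertex has degree $3$, counting dangling edges. To join two dangling edges, incident to vertices $p$ and $q$ respectively, means to remove them both and add one edge $pq$. The $4$-pole $W(i_1,i_2,o_1,o_2)$ is obtained from $P$ by removing two adjacent vertices $u,v$ together with the edge $uv$, and keeping as dangling edges the four other edges incident to $u$ or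 $v$: those originally incident to $u$ are called $i_1,o_1$, and those originally incident to $v$ are called $i_2,o_2$. It has $8$ vertices. (By the symmetry of $P$ the labelled $4$-pole does not depend on the choices made.) The $5$-pole $F$ is obtained from two disjoint copies $W_{\mathrm{top}}$ and $W_{\mathrm{bot}}$ of $W$, with dangling edges $i_{1t},i_{2t},o_{1t},o_{2t}$ and $i_{1b},i_{2b},o_{1b},o_{2b}$ respectively, as follows: join $o_{2t}$ to $i_{1b}$; join $o_{1t}$ to $i_{2b}$ and subdivide the resulting edge with one new vertex, to which a new dangling edge $e$ is attached. The five dangling edges of $F$ are the red ones $R=\{r^1,r^2\}$ with $r^1=i_{1t}$, $r^2=o_{2b}$; the blue ones $B=\{b^1,b^2\}$ with $b^1=i_{2t}$, $b^2=o_{1b}$; and the green one $e$. *)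

(* Defs.v *)
From mathcomp Require Import all_boot all_order all_algebra.

Set Implicit Arguments.
Unset Strict Implicit.
Unset Printing Implicit Defensive.

Import GRing.Theory.
Local Open Scope ring_scope.

(* Parallel edges and loops are allowed; the order of the two ends of an edge
   carries no meaning. *)
Record graph := Graph {
  vertex : finType;
  edge : finType;
  ends : edge -> vertex * vertex
}.

Definition incident (G : graph) (x : vertex G) (e : edge G) : bool :=
  (x == (ends e).1) || (x == (ends e).2).

Definition adjacent (G : graph) (e f : edge G) : bool :=
  (e != f) && [exists x, incident x e && incident x f].

(* A multipole whose set of dangling edges is K: the edges with no free end are
   [pedge], with their two ends [pends], and the only end of the dangling edge
   k which is not free is the vertex [dangling k].  Edges with two free ends do
   not occur. *)
Record multipole (K : Type) := Multipole {
  pvertex : finType;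
  pedge : finType;
  pends : pedge -> pvertex * pvertex;
  dangling : K -> pvertex
}.

(* The Petersen graph as the generalized Petersen graph GP(5,2), with outer
   vertices [inl i], inner vertices [inr i] and indices modulo 5. *)
Definition petersen_ends (e : 'I_5 + 'I_5 + 'I_5) :
    ('I_5 + 'I_5) * ('I_5 + 'I_5) :=
  match e with
  | inl (inl i) => (inl i, inl (i + 1))
  | inl (inr i) => (inl i, inr i)
  | inr i => (inr i, inr (i + 2))
  end.

Definition petersen : graph :=
  @Graph ('I_5 + 'I_5)%type ('I_5 + 'I_5 + 'I_5)%type petersen_ends.

Definition petersen_coloring (G : graph) (phi : edge G -> edge petersen) :
    Prop :=
  forall e f : edge G, adjacent e f -> adjacent (phi e) (phi f).

(* The two adjacent vertices removed from the Petersen graph to obtain W.  Its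
   automorphism group is simply transitive on paths o1, u, v, o2 with three
   edges, so the labelled 4-pole does not depend on these choices. *)
Definition Wu : vertex petersen := inl 0.
Definition Wv : vertex petersen := inr 0.

Definition W_vertex : finType :=
  {x : vertex petersen | (x != Wu) && (x != Wv)}.

Definition W_edge : finType :=
  {e : edge petersen | ~~ incident Wu e && ~~ incident Wv e}.

Lemma W_end1_proof (e : W_edge) :
  ((ends (val e)).1 != Wu) && ((ends (val e)).1 != Wv).
Proof.
by case: e => e /= /andP[]; rewrite !negb_or !(eq_sym _ (ends e).1);
  move=> /andP[-> _] /andP[-> _].
Qed.

Lemma W_end2_proof (e : W_edge) :
  ((ends (val e)).2 != Wu) && ((ends (val e)).2 != Wv).
Proof.
by case: e => e /= /andP[]; rewrite !negb_or !(eq_sym _ (ends e).2);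
  move=> /andP[_ ->] /andP[_ ->].
Qed.

Definition W_ends (e : W_edge) : W_vertex * W_vertex :=
  (Sub (ends (val e)).1 (W_end1_proof e), Sub (ends (val e)).2 (W_end2_proof e)).

Inductive W_label := Wi1 | Wi2 | Wo1 | Wo2.

(* The edges of the Petersen graph that become dangling: i1, o1 are incident to
   [Wu] and i2, o2 to [Wv]. *)
Definition W_label_edge (k : W_label) : edge petersen :=
  match k with
  | Wi1 => inl (inl 0)
  | Wo1 => inl (inl 4)
  | Wi2 => inr 0
  | Wo2 => inr 3
  end.

Definition W_dangling (k : W_label) : W_vertex :=
  match k with
  | Wi1 => Sub (inl 1) isT
  | Wo1 => Sub (inl 4) isT
  | Wi2 => Sub (inr 2) isT
  | Wo2 => Sub (inr 3) isT
  end.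

Lemma W_danglingP (k : W_label) :
  incident (if k is (Wi1 | Wo1) then Wu else Wv) (W_label_edge k) &&
  incident (val (W_dangling k)) (W_label_edge k).
Proof. by case: k. Qed.

Definition W : multipole W_label := Multipole W_ends W_dangling.

(* The top copy of W is on the left, the bottom copy in the middle, and the
   subdividing vertex is [inr tt]. *)
Definition F_vertex : finType := (pvertex W + pvertex W + unit)%type.

Definition F_edge : finType := (pedge W + pedge W + option bool)%type.

Definition Ftop (x : pvertex W) : F_vertex := inl (inl x).
Definition Fbot (x : pvertex W) : F_vertex := inl (inr x).
Definition Fmid : F_vertex := inr tt.

(* [inr None] is the edge joining o2t to i1b; [inr (Some false)] and
   [inr (Some true)] are the halves of the subdivided edge joining o1t to
   i2b. *)
Definition F_ends (e : F_edge) : F_vertex * F_vertex :=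
  match e with
  | inl (inl d) => (Ftop (pends d).1, Ftop (pends d).2)
  | inl (inr d) => (Fbot (pends d).1, Fbot (pends d).2)
  | inr None => (Ftop (dangling W Wo2), Fbot (dangling W Wi1))
  | inr (Some false) => (Ftop (dangling W Wo1), Fmid)
  | inr (Some true) => (Fmid, Fbot (dangling W Wi2))
  end.

Inductive F_label := Fr1 | Fr2 | Fb1 | Fb2 | Fe.

Definition F_dangling (k : F_label) : F_vertex :=
  match k with
  | Fr1 => Ftop (dangling W Wi1)
  | Fr2 => Fbot (dangling W Wo2)
  | Fb1 => Ftop (dangling W Wi2)
  | Fb2 => Fbot (dangling W Wo1)
  | Fe => Fmid
  end.

Definition F : multipole F_label := Multipole F_ends F_dangling.

Definition G52_vertex : finType := ('I_3 * pvertex F + unit)%type.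

Definition G52_edge : finType := ('I_3 * pedge F + 'I_3 * bool + 'I_3)%type.

Definition Gcopy (i : 'I_3) (x : pvertex F) : G52_vertex := inl (i, x).
Definition Gcenter : G52_vertex := inr tt.

(* [inl (inr (i, false))] joins b1 of copy i to r2 of copy i + 1,
   [inl (inr (i, true))] joins b2 of copy i to r1 of copy i + 1, and [inr i] is
   the green edge of copy i; the indices i : 'I_3 are modulo 3. *)
Definition G52_ends (e : G52_edge) : G52_vertex * G52_vertex :=
  match e with
  | inl (inl (i, d)) => (Gcopy i (pends d).1, Gcopy i (pends d).2)
  | inl (inr (i, false)) =>
      (Gcopy i (dangling F Fb1), Gcopy (i + 1) (dangling F Fr2))
  | inl (inr (i, true)) =>
      (Gcopy i (dangling F Fb2), Gcopy (i + 1) (dangling F Fr1))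
  | inr i => (Gcopy i (dangling F Fe), Gcenter)
  end.

Definition G52 : graph := Graph G52_ends.

(* Main.v *)
Require Import Defs.
From mathcomp Require Import all_boot.
From mathcomp Require Import all_algebra.

(** Let the four dangling edges of [W] have the colors i1, i2, o1, o2 in a
    Petersen coloring.  Since every 4-pole carries an F_2-flow with values in
    the cycle space of the Petersen graph, these colors either come in two
    equal pairs or are the four edges around an edge of the Petersen graph.  A
    search over the colorings of [W] leaves only two cases: o1 = i1 and o2 = i2,
    where i1 and i2 are equal, adjacent or joined by an edge; or i1, o1 meet at
    one end of an edge of which i2, o2 meet at the other.  Composing this
    relation gives the possible colors on the boundary of [F], and no three of
    these close up cyclically when the green edges meet at a vertex. *)

Set Implicit Arguments.
Unset Strict Implicit.
Unset Printing Implicit Defensive.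

(** Unlike [adjacent], this has no quantifier over vertices, so [vm_compute] can decide it. *)
Definition meet (G : graph) (e f : edge G) : bool :=
  (e != f) && (incident (ends e).1 f || incident (ends e).2 f).

Lemma adjacentE (G : graph) (e f : edge G) : adjacent e f = meet e f.
Proof.
rewrite /adjacent /meet; congr (_ && _); apply/existsP/idP.
  by case=> x /andP[/orP[]/eqP-> ->]; rewrite ?orbT.
case/orP=> h; [exists (ends e).1 | exists (ends e).2];
  by rewrite h andbT /incident eqxx ?orbT.
Qed.

(** The Petersen graph has no triangle, so a star in it consists of the three edges at one
    vertex. *)
Definition star (G : graph) (e f g : edge G) : bool :=
  [&& meet e f, meet e g & meet f g].

Lemma coloring_star (G : graph) (phi : edge G -> edge petersen) e f g :
  petersen_coloring phi -> star e f g -> star (phi e) (phi f) (phi g).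
Proof.
move=> col; rewrite /star -!adjacentE.
by move=> /and3P[/col-> /col-> /col->].
Qed.

(* The searches below run on the numbers of the edges in this list, as nat is
   much faster than the type of edges: the rim edge, the spoke and the inner
   edge of index i get the numbers i, 5 + i and 10 + i. *)
Definition petersen_edges : seq (edge petersen) :=
  let I5 := [:: 0; 1; 2; 3; 4]%R : seq 'I_5 in
  [seq inl (inl i) | i <- I5] ++ [seq inl (inr i) | i <- I5] ++
  [seq inr i | i <- I5].

Definition colors : seq nat := iota 0 15.

Definition color (e : edge petersen) : nat := index e petersen_edges.

Lemma mem_petersen_edges (e : edge petersen) : e \in petersen_edges.
Proof. by case: e => [[]|] [[|[|[|[|[|]]]]]]. Qed.

Lemma mem_colors (e : edge petersen) : color e \in colors.
Proof. by case: e => [[]|] [[|[|[|[|[|]]]]]]. Qed.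

Definition mates_table : seq (seq (nat * nat)) := Eval vm_compute in
  [seq [seq (color f, color g) | f <- petersen_edges,
          g <- [seq g <- petersen_edges | star e f g]] | e <- petersen_edges].

Definition mates (a : nat) : seq (nat * nat) := nth [::] mates_table a.

Lemma mem_mates (e f g : edge petersen) :
  star e f g -> (color f, color g) \in mates (color e).
Proof.
pose P e f g := star e f g ==> ((color f, color g) \in mates (color e)).
have all_star : all (fun e => all (fun f => all (P e f) petersen_edges)
  petersen_edges) petersen_edges by vm_compute.
have in_edges := mem_petersen_edges.
move/allP/(_ e (in_edges e))/allP/(_ f (in_edges f)): all_star.
by move/allP/(_ g (in_edges g))/implyP.
Qed.

Definition thirds (a b : nat) : seq nat := [seq p.2 | p <- mates a & p.1 == b].

Lemma mem_thirds (a b c : nat) : (b, c) \in mates a -> c \in thirds a b.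
Proof.
by move=> abc; apply/mapP; exists (b, c); rewrite // mem_filter eqxx.
Qed.

(** Distance at most 2 in the line graph of the Petersen graph. *)
Definition near (a b : nat) : bool :=
  (a == b) || has (fun p => (p.1 == b) || has (fun q => q.1 == b) (mates p.1))
                  (mates a).

(** In the second list [pq.1.2] is the central edge; the condition on [b] puts [a] and [b] at
    opposite ends of it. *)
Definition W_out (a b : nat) : seq (nat * nat) :=
  (if near a b then [:: (a, b)] else [::]) ++
  [seq (pq.1.1, pq.2.1) | pq <- [seq (p, q) | p <- mates a, q <- mates b]
     & (pq.1.2 == pq.2.2) && (b \notin [:: a; pq.1.1])].

(** The vertices of [W] are visited so that each has a colored edge already; where two are colored,
    [thirds] prunes the search. *)
Definition W_check : bool :=
  all (fun p0 =>
  all (fun '(p1, p6) =>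
  all (fun '(p2, p7) =>
  all (fun '(p11, p14) =>
  all (fun '(p9, p12) =>
  all (fun p10 =>
  all (fun '(p3, p8) =>
  all (fun p13 =>
  all (fun p4 => (p4, p13) \in W_out p0 p10)
    (thirds p3 p9)) (thirds p8 p11)) (mates p2)) (thirds p7 p12)) (mates p14))
    (mates p6)) (mates p1)) (mates p0)) colors.

Lemma W_checkT : W_check.
Proof. by vm_compute. Qed.

(* The edges of [W], dangling ones included, are named by their numbers as
   edges of the Petersen graph: i1, o1, i2, o2 are 0, 4, 10, 13. *)
Definition W_stars : seq (nat * nat * nat) :=
  [:: (0, 1, 6); (1, 2, 7); (6, 11, 14); (14, 9, 12); (7, 12, 10); (2, 3, 8);
      (8, 11, 13); (3, 9, 4)].

Lemma W_outP (G : graph) (phi : edge G -> edge petersen) (psi : nat -> edge G) :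
    petersen_coloring phi ->
    all (fun '(x, y, z) => star (psi x) (psi y) (psi z)) W_stars ->
  (color (phi (psi 4)), color (phi (psi 13))) \in
    W_out (color (phi (psi 0))) (color (phi (psi 10))).
Proof.
move=> col /allP stars; set c := fun n => color (phi (psi n)).
have mem x y z : (x, y, z) \in W_stars -> (c y, c z) \in mates (c x).
  by move=> /stars st; apply/mem_mates/(coloring_star col).
move/allP/(_ (c 0) (mem_colors _)): W_checkT.
move/allP/(_ _ (mem 0 1 6 isT))/allP/(_ _ (mem 1 2 7 isT)).
move/allP/(_ _ (mem 6 11 14 isT))/allP/(_ _ (mem 14 9 12 isT)).
move/allP/(_ _ (mem_thirds (mem 7 12 10 isT)))/allP/(_ _ (mem 2 3 8 isT)).
move/allP/(_ _ (mem_thirds (mem 8 11 13 isT))).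
by move/allP/(_ _ (mem_thirds (mem 3 9 4 isT))).
Qed.

(* The possible colors of r2 and b2. *)
Definition F_out (e r1 b1 : nat) : seq (nat * nat) :=
  flatten [seq [seq (bot.2, bot.1) | i2b <- thirds e top.1,
                  bot <- W_out top.2 i2b] | top <- W_out r1 b1].

(* The possible colors of b2 and b1, in this order because b2 is joined to r1
   and b1 to r2 of the next copy of [F]. *)
Definition F_next (e r1 r2 : nat) : seq (nat * nat) :=
  [seq (q.2, b1) | b1 <- colors, q <- [seq q <- F_out e r1 b1 | q.1 == r2]].

Lemma mem_F_next e r1 r2 b1 b2 :
  b1 \in colors -> (r2, b2) \in F_out e r1 b1 -> (b2, b1) \in F_next e r1 r2.
Proof.
move=> b1_col rb; apply/allpairsPdep; exists b1, (r2, b2).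
by rewrite mem_filter eqxx.
Qed.

(** Tabulated since [ring_check] asks for the same transitions many times. *)
Definition F_table : seq (seq (seq (seq (nat * nat)))) :=
  [seq [seq [seq F_next e r1 r2 | r2 <- colors] | r1 <- colors] | e <- colors].

Definition F_step (e : nat) (r : nat * nat) : seq (nat * nat) :=
  nth [::] (nth [::] (nth [::] F_table e) r.1) r.2.

Lemma F_stepE e r :
  e \in colors -> r.1 \in colors -> r.2 \in colors ->
  F_step e r = F_next e r.1 r.2.
Proof.
rewrite !mem_iota /= => lt_e lt_r1 lt_r2.
by rewrite /F_step !(nth_map 0) ?size_iota // !nth_iota.
Qed.

Definition ring_check : bool :=
  all (fun e1 => all (fun '(e2, e3) =>
    all (fun r1 => all (fun r2 => all (fun s => all (fun t =>
      (r1, r2) \notin F_step e3 t)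
    (F_step e2 s)) (F_step e1 (r1, r2))) colors) colors)
  (mates e1)) colors.

Lemma ring_checkT : ring_check.
Proof. by vm_compute. Qed.

Lemma F_step_acyclic e1 e2 e3 r s t :
    e1 \in colors -> r.1 \in colors -> r.2 \in colors ->
    (e2, e3) \in mates e1 ->
    s \in F_step e1 r -> t \in F_step e2 s -> r \notin F_step e3 t.
Proof.
case: r => r1 r2 e1_col r1_col r2_col e123 rs st.
move: ring_checkT => /allP/(_ _ e1_col)/allP/(_ _ e123).
by move=> /allP/(_ _ r1_col)/allP/(_ _ r2_col)/allP/(_ _ rs)/allP/(_ _ st).
Qed.

(* The edges of a copy of [W] in [G52], under the names of [W_stars]. *)
Definition W_copy (k : W_edge -> edge G52) (l : W_label -> edge G52) (n : nat) :
    edge G52 :=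
  match n with
  | 0 => l Wi1 | 4 => l Wo1 | 10 => l Wi2 | 13 => l Wo2
  | 1 => k (Sub (inl (inl 1%R)) isT)
  | 2 => k (Sub (inl (inl 2%R)) isT)
  | 3 => k (Sub (inl (inl 3%R)) isT)
  | 6 => k (Sub (inl (inr 1%R)) isT)
  | 7 => k (Sub (inl (inr 2%R)) isT)
  | 8 => k (Sub (inl (inr 3%R)) isT)
  | 9 => k (Sub (inl (inr 4%R)) isT)
  | 11 => k (Sub (inr 1%R) isT)
  | 12 => k (Sub (inr 2%R) isT)
  | _ => k (Sub (inr 4%R) isT)
  end.

Definition r1 (i : 'I_3) : edge G52 := inl (inr (i - 1, true)%R).
Definition r2 (i : 'I_3) : edge G52 := inl (inr (i - 1, false)%R).
Definition b1 (i : 'I_3) : edge G52 := inl (inr (i, false)).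
Definition b2 (i : 'I_3) : edge G52 := inl (inr (i, true)).
Definition green (i : 'I_3) : edge G52 := inr i.
Definition inner (i : 'I_3) (d : pedge F) : edge G52 := inl (inl (i, d)).

Definition top (i : 'I_3) : nat -> edge G52 :=
  W_copy (fun d => inner i (inl (inl d)))
    (fun k => match k with
     | Wi1 => r1 i
     | Wi2 => b1 i
     | Wo1 => inner i (inr (Some false))
     | Wo2 => inner i (inr None)
     end).

Definition bot (i : 'I_3) : nat -> edge G52 :=
  W_copy (fun d => inner i (inl (inr d)))
    (fun k => match k with
     | Wi1 => inner i (inr None)
     | Wi2 => inner i (inr (Some true))
     | Wo1 => b2 i
     | Wo2 => r2 i
     end).

Lemma top_stars i :
  all (fun '(x, y, z) => star (top i x) (top i y) (top i z)) W_stars.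
Proof. by case: i => [[|[|[|//]]]] ?; vm_compute. Qed.

Lemma bot_stars i :
  all (fun '(x, y, z) => star (bot i x) (bot i y) (bot i z)) W_stars.
Proof. by case: i => [[|[|[|//]]]] ?; vm_compute. Qed.

Lemma mid_star i :
  star (green i) (inner i (inr (Some false))) (inner i (inr (Some true))).
Proof. by case: i => [[|[|[|//]]]] ?; vm_compute. Qed.

(** The green edges come in the order in which three steps from copy [i] use them. *)
Lemma center_star i :
  star (green (i + 1)%R) (green (i + 1 + 1)%R) (green i).
Proof. by case: i => [[|[|[|//]]]] ?; vm_compute. Qed.

Section Coloring.

Variable phi : edge G52 -> edge petersen.
Hypothesis col : petersen_coloring phi.

Let c (e : edge G52) : nat := color (phi e).

Lemma mem_F_out i :
  (c (r2 i), c (b2 i)) \in F_out (c (green i)) (c (r1 i)) (c (b1 i)).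
Proof.
have st := mem_mates (coloring_star col (mid_star i)).
apply/flatten_mapP; eexists; first exact: (W_outP col (top_stars i)).
apply/allpairsPdep; do 2!eexists; split; first exact: (mem_thirds st).
  exact: (W_outP col (bot_stars i)).
by [].
Qed.

Lemma mem_F_step i :
  (c (b2 (i + 1)), c (b1 (i + 1)))%R \in
    F_step (c (green (i + 1)%R)) (c (b2 i), c (b1 i)).
Proof.
rewrite F_stepE ?mem_colors //.
apply/mem_F_next; first exact: mem_colors.
(* [r1] and [r2] of copy [i + 1] are [b2] and [b1] of copy [i]. *)
by have := mem_F_out (i + 1)%R; rewrite /r1 /r2 GRing.addrK.
Qed.

End Coloring.

Theorem theorem5 :
  ~ exists phi : edge G52 -> edge petersen, petersen_coloring phi.
Proof.
case=> phi col; pose i : 'I_3 := 0%R.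
have i3 : (i + 1 + 1 + 1)%R = i by apply/val_inj.
have e123 := mem_mates (coloring_star col (center_star i)).
have step3 := mem_F_step col (i + 1 + 1)%R; rewrite i3 in step3.
apply: (negP (F_step_acyclic _ _ _ e123 (mem_F_step col i)
  (mem_F_step col (i + 1)%R))) step3; exact: mem_colors.
Qed.
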